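(* Let $X_1,X_2,\ldots$ be i.i.d. nonnegative random variables with common distribution function $F\in\mathcal{F}$, and let $N$ be a random variable with values in $\{0,1,2,\ldots\}$, independent of $(X_i)$, with $\mathbb{P}(N=0)<1$. Let $F_N$ be the distribution function of $S_N:=\sum_{i=1}^N X_i$, and let $N_1,N_2$ be two independent copies of $N$. Suppose $$\liminf_{n\to\infty}\frac{\mathbb{P}(N_1+N_2>n)}{\mathbb{P}(N_1>n)}>c_{F_N}:=\limsup_{x\to\infty}\frac{\overline{F_N^{2*}}(x)}{\overline{F_N}(x)}.$$ Then the following assertions hold. (a) If $F_N\in\mathcal{OS}$, then there exists $m\in\mathbb{N}$ such that $\overline{F^{m*}}\asymp\overline{F_N}$. (b) If $F_N\in\mathcal{J}$, then $\overline{F}\asymp\overline{F_N}$ and hence $F\in\mathcal{J}$.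
   Context: Let $\mathcal{F}$ be the set of all distribution functions of nonnegative random variables with unbounded support, and write $\overline{H}=1-H$. $H^{m*}$ denotes the $m$-fold convolution of $H$ with itself. The ratio $\mathbb{P}(N_1+N_2>n)/\mathbb{P}(N_1>n)$ in the hypothesis is understood to be well defined, i.e. $\mathbb{P}(N>n)>0$ for all $n$. For positive functions $f,g$ on $[0,\infty)$, $f\asymp g$ means $0<\liminf_{x\to\infty}f(x)/g(x)\le\limsup_{x\to\infty}f(x)/g(x)<\infty$. $\mathcal{OS}$ is the class of $H\in\mathcal{F}$ with $\limsup_{x\to\infty}\overline{H^{2*}}(x)/\overline{H}(x)<\infty$. The class $\mathcal{J}$ is the set of all $H\in\mathcal{F}$ such that, for $Y_1,Y_2,\ldots$ i.i.d. with distribution function $H$ and for all $n\ge2$, $$\lim_{K\to\infty}\liminf_{x\to\infty}\frac{\mathbb{P}(\max(Y_1,\ldots,Y_n)>x-K,\;Y_1+\cdots+Y_n>x)}{\mathbb{P}(Y_1+\cdots+Y_n>x)}=1.$$ *)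

(* Defs.v *)
From HB Require Import structures.
From mathcomp Require Import all_boot all_order all_algebra.
From mathcomp Require Import finmap.
From mathcomp Require Import all_classical all_reals all_analysis.
From mathcomp Require Import measurable_realfun.

Set Implicit Arguments.
Unset Strict Implicit.
Unset Printing Implicit Defensive.

Import Order.TTheory GRing.Theory Num.Theory.
Import numFieldNormedType.Exports.

Local Open Scope classical_set_scope.
Local Open Scope ring_scope.

(* A distribution function on the line is represented by the probability
   measure it determines: H stands for x |-> H `]-oo, x].  Only the values of H
   on measurable sets are meaningful, so laws are compared with [same_law],
   never with [=]. *)
Definition same_law {d} {T : measurableType d} {R : realType}
    (mu nu : probability T R) : Prop :=
  forall A, measurable A -> mu A = nu A.

Definition tail {R : realType} (H : probability R R) (x : R) : R :=
  fine (H `]x, +oo[%classic).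

Definition class_F {R : realType} (H : probability R R) : Prop :=
  H `[0, +oo[%classic = 1%E /\ forall x : R, 0 < tail H x.

Definition pair_sum {R : realType} (p : R * R) : R := p.1 + p.2.

Lemma measurable_pair_sum (R : realType) :
  measurable_fun setT (@pair_sum R).
Proof. by apply: measurable_funD; [exact: measurable_fst|exact: measurable_snd]. Qed.

HB.instance Definition _ (R : realType) :=
  isMeasurableFun.Build _ _ _ _ (@pair_sum R) (@measurable_pair_sum R).

Definition conv {R : realType} (H G : probability R R) : probability R R :=
  distribution (H \x G)%E (@pair_sum R).

(* [conv_pow H m] is the m-fold convolution; the 0-fold one is the unit mass
   at 0. *)
Fixpoint conv_pow {R : realType} (H : probability R R) (m : nat) :
    probability R R :=
  if m is m'.+1 then conv H (conv_pow H m') else \d_(0 : R).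

Definition ereal_ratio {T : Type} {R : realType} (f g : T -> R) (x : T) : \bar R :=
  (f x / g x)%:E.

(* Meaningful for eventually positive f and g: the quotient is a total
   function, equal to 0 where g vanishes. *)
Definition asymp_equiv {R : realType} (f g : R -> R) : Prop :=
  (0 < limf_einf (ereal_ratio f g) +oo%R)%E /\
  (limf_esup (ereal_ratio f g) +oo%R < +oo)%E.

Definition limsup_conv_ratio {R : realType} (H : probability R R) : \bar R :=
  limf_esup (ereal_ratio (tail (conv_pow H 2)) (tail H)) +oo%R.

Definition class_OS {R : realType} (H : probability R R) : Prop :=
  class_F H /\ (limsup_conv_ratio H < +oo)%E.

Definition independent_systems {d} {T : measurableType d} {R : realType}
    (P : probability T R) (G1 G2 : set (set T)) : Prop :=
  forall A B, G1 A -> G2 B -> P (A `&` B) = (P A * P B)%E.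

Definition sigma_of {d d'} {T : measurableType d} {T' : measurableType d'}
    (X : T -> T') : set (set T) :=
  preimage_set_system setT X measurable.

Definition sigma_of_family {d d'} {T : measurableType d}
    {T' : measurableType d'} {I : Type} (X : I -> {mfun T >-> T'}) : set (set T) :=
  <<s \bigcup_i sigma_of (X i) >>.

Definition mutually_independent {d d'} {T : measurableType d}
    {T' : measurableType d'} {R : realType} (P : probability T R)
    {I : choiceType} (X : I -> {RV P >-> T'}) : Prop :=
  forall (J : {fset I}) (A : I -> set T'),
    (forall i, measurable (A i)) ->
    P (\bigcap_(i in [set` J]) (X i @^-1` A i)) =
    (\prod_(i <- J) P (X i @^-1` A i))%E.

Definition iid_with_law {d d'} {T : measurableType d} {T' : measurableType d'}
    {R : realType} (P : probability T R) {I : choiceType}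
    (X : I -> {RV P >-> T'}) (H : probability T' R) : Prop :=
  mutually_independent X /\ forall i, same_law (distribution P (X i)) H.

(* The ratio depends on Y only through the n-fold product of H, and families
   Y_1, ..., Y_n exist on that product, so quantifying over all of them is the
   same as fixing one.  The maximum is taken in the extended reals, where -oo
   is the neutral element. *)
Definition class_J {R : realType} (H : probability R R) : Prop :=
  class_F H /\
  forall n : nat, (2 <= n)%N ->
  forall (d : measure_display) (T : measurableType d) (P : probability T R)
    (Y : 'I_n -> {RV P >-> R}), iid_with_law Y H ->
  limf_einf
    (ereal_ratio
      (fun x : R => fine (P [set w |
         ((x - K)%:E < \big[maxe/-oo]_(i < n) (Y i w)%:E)%E /\
         x < \sum_(i < n) Y i w]))
      (fun x : R => fine (P [set w | x < \sum_(i < n) Y i w])))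
    +oo%R @[K --> +oo%R] --> 1%E.

(* X 0, X 1, ... play the role of X_1, X_2, ... *)
Definition random_sum {d} {T : measurableType d} {R : realType}
    {P : probability T R} (X : nat -> {RV P >-> R}) (N : {RV P >-> nat})
    (w : T) : R :=
  \sum_(i < N w) X i w.

Lemma measurable_random_sum {d} {T : measurableType d} {R : realType}
    {P : probability T R} (X : nat -> {RV P >-> R}) (N : {RV P >-> nat}) :
  measurable_fun setT (random_sum X N).
Proof.
move=> _ B mB; rewrite setTI.
have -> : random_sum X N @^-1` B = \bigcup_n
    (N @^-1` [set n] `&` (fun w => \sum_(i < n) X i w) @^-1` B).
  apply/seteqP; split=> [w Bw|w [n _ []]] /=; first by exists (N w).
  by rewrite /random_sum => <-.
apply: bigcup_measurable => n _; apply: measurableI.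
  by rewrite -[X in measurable X]setTI; apply: measurable_funP.
rewrite -[X in measurable X]setTI.
suff: measurable_fun setT (fun w => \sum_(i < n) X i w) by apply.
exact: measurable_sum.
Qed.

HB.instance Definition _ d (T : measurableType d) (R : realType)
    (P : probability T R) (X : nat -> {RV P >-> R}) (N : {RV P >-> nat}) :=
  isMeasurableFun.Build _ _ _ _ (random_sum X N) (measurable_random_sum X N).

Definition random_sum_law {d} {T : measurableType d} {R : realType}
    {P : probability T R} (X : nat -> {RV P >-> R}) (N : {RV P >-> nat}) :
    probability R R :=
  distribution P (random_sum X N).

(* Main.v *)
Require Import Defs.
From HB Require Import structures.
From mathcomp Require Import all_boot all_order all_algebra finmap.
From mathcomp Require Import all_classical all_reals all_analysis.
From mathcomp Require Import measurable_realfun ring lra.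

(** Write F_n for the n-fold convolution of F, G for the law of S_N, and
    f_n, g for the tails of F_n and G.  The increments d_k = f_(k+1) - f_k are
    nonnegative because F lives on the half-line, and conditioning on the
    number of summands gives, for x >= 0,
      g(x) = sum_k P(N > k) d_k(x),
      tail of G*G at x = sum_k P(N1 + N2 > k) d_k(x)
    ([tail_random_sum], [tail_conv_random_sum]).

    Part (a).  Let c_G be the limsup of the ratio of the tails of G*G and G, and
    choose c < b strictly between the two sides of the hypothesis.
    For k >= n the second series dominates b times the first one term by term,
    whereas its sum is at most c g(x) for large x.  Hence (b - c) g is at most
    b times the sum of the first n increments, that is b f_n
    ([random_sum_le_conv_pow]).  Conversely P(N > m) f_m <= g for every m,
    since the partial sums increase ([tail_conv_pow_le_random_sum]).

    Part (b).  The hypothesis forces c_G to be finite, so g(x - K) = O(g(x)) for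
    each fixed K, and property J of G for two summands becomes tightness of the
    smaller of the two: for independent Z1, Z2 of law G,
      P(Z1 > K, Z2 > K, Z1 + Z2 > x) <= e g(x)
    for a suitable K = K(e) and all large x ([class_J_one_big_of_two]).  This
    event is increasing in both coordinates, so the bound survives, up to a
    constant, when the laws of Z1 and Z2 are replaced by laws whose tails are
    O(g), in particular by F and F_n ([both_exceed_dominated2]).  Now let
    Y_0, ..., Y_n be independent of law F with sum S > x >= (n + 1) K, and
    suppose that no Y_i exceeds x - K.  Some Y_i exceeds K, and then so does
    S - Y_i, which is independent of Y_i and has law F_n.  Therefore
      P(S > x, max Y_i <= x - K) <= e g(x)    for large x
    ([no_big_jump_negligible]).  This single estimate is used twice.  With n
    from part (a), where g = O(f_(n+1)), it gives g(x) = O(P(Y_0 > x - K)),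
    hence g = O(f) ([class_J_dominated_by_step]).  Once g = O(f) is known, the
    right-hand side is negligible against P(S > x) >= f(x) for every n, which
    is property J for F ([class_J_of_domination]). *)

Set Implicit Arguments.
Unset Strict Implicit.
Unset Printing Implicit Defensive.

Import Order.TTheory GRing.Theory Num.Theory.
Import numFieldNormedType.Exports.

Local Open Scope classical_set_scope.
Local Open Scope ring_scope.

(* Convexity theory uses the name conv as well. *)
Local Notation conv := Defs.conv.

(** * Convolution of laws *)

Lemma measurable_translate (R : realType) (A : set R) (a : R) :
  measurable A -> measurable [set b | A (a + b)].
Proof.
move=> mA; rewrite -[X in measurable X]setTI.
suff : measurable_fun setT (fun b : R => a + b) by apply.
exact: measurable_funD.
Qed.

Lemma convE (R : realType) (H G : probability R R) (A : set R) :
  conv H G A = (\int[H]_a G [set b | A (a + b)%R])%E.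
Proof.
apply: eq_integral => a _ /=; congr (G _).
by apply/seteqP; split => b; rewrite /xsection/= ?inE.
Qed.

Lemma measurable_fun_translate (R : realType) (G : probability R R)
    (A : set R) : measurable A ->
  measurable_fun setT (fun a : R => G [set b : R | A (a + b)]).
Proof.
move=> mA.
have mB : measurable (@pair_sum R @^-1` A) by exact: measurable_funPTI.
have := measurable_fun_xsection G mB; apply: eq_measurable_fun => a _ /=.
by congr (G _); apply/seteqP; split => b; rewrite /xsection/= ?inE.
Qed.

Lemma eq_conv (R : realType) (H H' G G' : probability R R) :
  same_law H H' -> same_law G G' -> same_law (conv H G) (conv H' G').
Proof.
move=> HH GG A mA; rewrite !convE.
under eq_integral do rewrite (GG _ (measurable_translate _ mA)).
by apply: eq_measure_integral => B mB _; exact: HH.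
Qed.

(** Both product measures, integrating first over either coordinate, agree. *)
Lemma conv_comm (R : realType) (H G : probability R R) :
  same_law (conv H G) (conv G H).
Proof.
move=> A mA.
have mB : measurable (@pair_sum R @^-1` A) by exact: measurable_funPTI.
transitivity ((H \x^ G)%E (@pair_sum R @^-1` A)).
  apply: product_measure_unique => // B C mB' mC.
  by rewrite /= product_measure2E.
rewrite convE; apply: eq_integral => a _ /=; congr (H _).
by apply/seteqP; split => b; rewrite /ysection/pair_sum/= ?inE/= addrC.
Qed.

Lemma conv_dirac0 (R : realType) (H : probability R R) :
  same_law (conv H (\d_(0 : R))) H.
Proof.
move=> A mA; rewrite convE -[in RHS](setIT A) -integral_indic//.
apply: eq_integral => a _; rewrite [LHS]diracE indicE; congr ((nat_of_bool _)%:R%:E).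
by apply/idP/idP; rewrite !inE/= addr0.
Qed.

(** By Tonelli, both sides integrate K (A - a - b) against H in a and G in b. *)
Lemma conv_assoc (R : realType) (H G K : probability R R) :
  same_law (conv (conv H G) K) (conv H (conv G K)).
Proof.
move=> A mA; rewrite !convE.
rewrite ge0_integral_distribution//; last exact: measurable_fun_translate.
rewrite fubini_tonelli1//; last first.
  apply: (measurableT_comp (measurable_fun_translate K mA)).
  exact: measurable_funP.
apply: eq_integral => a _; rewrite convE /fubini_F; apply: eq_integral => b _/=.
by congr (K _); apply/seteqP; split => c; rewrite /pair_sum/= addrA.
Qed.

Lemma conv_pow1 (R : realType) (H : probability R R) :
  same_law (conv_pow H 1) H.
Proof. exact: conv_dirac0. Qed.

Lemma same_law_trans (R : realType) (H G K : probability R R) :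
  same_law H G -> same_law G K -> same_law H K.
Proof. by move=> HG GK A mA; rewrite HG// GK. Qed.

Lemma same_law_sym (R : realType) (H G : probability R R) :
  same_law H G -> same_law G H.
Proof. by move=> HG A mA; rewrite HG. Qed.

Lemma conv_powD (R : realType) (H : probability R R) (m n : nat) :
  same_law (conv (conv_pow H m) (conv_pow H n)) (conv_pow H (m + n)).
Proof.
elim: m => [|m IH]; first exact: same_law_trans (conv_comm _ _) (conv_dirac0 _).
by apply: same_law_trans (conv_assoc _ _ _) _; exact: eq_conv.
Qed.

(** Applied to each of the two factors, this computes the square of the law of a
    random sum. *)
Lemma conv_mixture (R : realType) (K H : probability R R)
    (p : nat -> \bar R) (h : nat -> probability R R) :
  (forall n, 0 <= p n)%E ->
  (forall A, measurable A -> H A = \sum_(n <oo) p n * h n A)%E ->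
  forall A, measurable A -> (conv K H A = \sum_(n <oo) p n * conv K (h n) A)%E.
Proof.
move=> p0 Hh A mA; rewrite convE.
under eq_integral do rewrite (Hh _ (measurable_translate _ mA)).
rewrite integral_nneseries//; last 2 first.
- by move=> n; apply: emeasurable_funM => //; exact: measurable_fun_translate.
- by move=> n a _; rewrite mule_ge0.
apply: eq_eseriesr => n _; rewrite convE ge0_integralZl//.
exact: measurable_fun_translate.
Qed.

(** * Sums of independent identically distributed variables *)

(** Scaled probabilities occur as the law of Y restricted to an event E
    independent of Y; finiteness makes uniqueness of product measures available. *)
Lemma mscale_fin_num (d : measure_display) (T : measurableType d)
    (R : realType) (c : {nonneg R}) (P : probability T R) :
  fin_num_fun (mscale c P).
Proof. by move=> A mA; rewrite /mscale/= fin_numM// fin_num_measure. Qed.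

HB.instance Definition _ (d : measure_display) (T : measurableType d)
    (R : realType) (c : {nonneg R}) (P : probability T R) :=
  @Measure_isFinite.Build _ _ _ (mscale c P) (mscale_fin_num c P).

Lemma measurable_partial_sum (d : measure_display) (T : measurableType d)
    (R : realType) (I : Type) (Y : I -> {mfun T >-> R}) (s : seq I) :
  measurable_fun setT (fun w => \sum_(i <- s) Y i w).
Proof. by apply: measurable_sum => i; exact: measurable_funP. Qed.

Lemma measurable_sum_gt (d : measure_display) (T : measurableType d)
    (R : realType) (I : Type) (Y : I -> {mfun T >-> R}) (s : seq I) (x : R) :
  measurable [set w | x < \sum_(i <- s) Y i w].
Proof.
have := measurable_partial_sum Y s measurableT (Y := `]x, +oo[%classic).
rewrite setTI => /(_ (measurable_itv _)); congr measurable.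
by apply/seteqP; split => w /=; rewrite in_itv/= andbT.
Qed.

Lemma measurable_cylinder (d : measure_display) (T : measurableType d)
    (R : realType) (I : choiceType) (Y : I -> {mfun T >-> R}) (L : {fset I})
    (A : I -> set R) : (forall i, measurable (A i)) ->
  measurable (\bigcap_(i in [set` L]) (Y i @^-1` A i)).
Proof.
move=> mA; apply: fin_bigcap_measurable => [|i _]; first exact: finite_fset.
exact: measurable_funPTI.
Qed.

(** The event E carries the remaining variables of an independent family; the
    constant c is its probability.  Keeping E general is what allows the
    induction in the next lemma to add one summand at a time. *)
Lemma restricted_joint_law (d : measure_display) (T : measurableType d)
    (R : realType) (P : probability T R) (Y S : T -> R) (E : set T)
    (c : {nonneg R}) (H K : probability R R) :
  measurable_fun setT Y -> measurable_fun setT S -> measurable E ->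
  (forall A B, measurable A -> measurable B ->
     P (Y @^-1` A `&` S @^-1` B `&` E) = c%:num%:E * (H A * K B))%E ->
  forall C, measurable C ->
    P ([set w | C (Y w, S w)] `&` E) = (c%:num%:E * (H \x K) C)%E.
Proof.
move=> mY mS mE rect C mC.
have mYS : measurable_fun setT (fun w => (Y w, S w)).
  exact: measurable_fun_pair.
pose f : {mfun T >-> (R * R)%type} :=
  HB.pack (fun w => (Y w, S w)) (isMeasurableFun.Build _ _ _ _ _ mYS).
transitivity ((mscale c H \x K)%E C).
  apply/esym.
  apply: (product_measure_unique (m' := pushforward (mrestr P mE) f)) => //.
  move=> A B mA mB /=; rewrite /pushforward/= /mrestr/= /mscale/= -muleA.
  by rewrite -rect.
by rewrite /product_measure1 ge0_integral_mscale//; exact: measurable_fun_xsection.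
Qed.

(** Induction on the summands: the hypothesis for s, applied with the next
    variable Y_j as one more coordinate of the cylinder, says that Y_j and the
    sum over s are independent on the cylinder event, which determines the law
    of their sum there. *)
Lemma iid_sum_cylinder (d : measure_display) (T : measurableType d)
    (R : realType) (P : probability T R) (I : choiceType)
    (Y : I -> {RV P >-> R}) (H : probability R R) : iid_with_law Y H ->
  forall (s : seq I) (L : {fset I}) (A : I -> set R) (B : set R),
  uniq s -> {in s, forall i, i \notin L} ->
  (forall i, measurable (A i)) -> measurable B ->
  P ([set w | B (\sum_(i <- s) Y i w)] `&`
       \bigcap_(i in [set` L]) (Y i @^-1` A i)) =
  (conv_pow H (size s) B * \prod_(i <- L) H (A i))%E.
Proof.
move=> [indY lawY]; elim=> [|j s IH] L A B.
  move=> _ _ mA mB.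
  have -> : (\prod_(i <- L) H (A i) = P (\bigcap_(i in [set` L]) (Y i @^-1` A i)))%E.
    by rewrite indY//; apply: eq_bigr => i _; rewrite -(lawY i).
  under eq_set do rewrite big_nil.
  rewrite /= diracE; case: (pselect (B 0)) => B0.
    rewrite mem_set// mul1e; congr (P _).
    by apply/seteqP; split => w // [].
  rewrite memNset// mul0e -[RHS](measure0 P); congr (P _).
  by apply/seteqP; split => w // [].
move=> /= /andP[js us] sL mA mB.
have prod_fin : (\prod_(i <- L) H (A i))%E \is a fin_num.
  by apply: prode_fin_num => i _; rewrite fin_num_measure.
have prod_ge0 : 0 <= fine (\prod_(i <- L) H (A i))%E.
  by rewrite fine_ge0// prode_ge0.
pose c := NngNum prod_ge0.
have mSpre : measurable (@pair_sum R @^-1` B) by exact: measurable_funPTI.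
transitivity (P ([set w | (@pair_sum R @^-1` B) (Y j w, \sum_(i <- s) Y i w)] `&`
       \bigcap_(i in [set` L]) (Y i @^-1` A i))).
  by congr (P (_ `&` _)); apply/seteqP; split => w /=; rewrite big_cons.
rewrite (@restricted_joint_law _ _ _ P _ _ _ c H (conv_pow H (size s)))//.
- by rewrite fineK// muleC.
- exact: measurable_partial_sum.
- exact: measurable_cylinder.
move=> A' B' mA' mB'.
have jL : j \notin L by apply: sL; rewrite mem_head.
have := IH (j |` L)%fset (fun i => if i == j then A' else A i) B' us.
rewrite big_fsetU1//= eqxx => IHj.
transitivity (P ([set w | B' (\sum_(i <- s) Y i w)] `&`
  \bigcap_(i in [set` (j |` L)%fset]) (Y i @^-1` (if i == j then A' else A i)))).
  congr (P _); apply/seteqP; split => w.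
    move=> [[Yj Sw] Aw]; split => // i /=; rewrite !inE => /orP[/eqP->|iL].
      by rewrite eqxx.
    by case: eqP => [->//|_]; exact: Aw.
  move=> [Sw Aw]; split; [split => //|].
    by have := Aw j; rewrite /= eqxx; apply; rewrite !inE eqxx.
  move=> i /= iL; have := Aw i; rewrite /= !inE iL orbT => /(_ isT).
  by case: eqP => // ij; rewrite -ij iL in jL.
rewrite IHj//; last 2 first.
- move=> i si; rewrite !inE negb_or; apply/andP; split.
    by apply: contraNneq js => <-.
  by apply: sL; rewrite inE si orbT.
- by move=> i; case: ifP.
rewrite fineK// muleC -muleA muleCA; congr (_ * _)%E.
rewrite [LHS]big_seq_cond [RHS]big_seq_cond; apply: eq_bigr => i; rewrite andbT.
by case: eqP => // -> jL'; rewrite jL' in jL.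
Qed.

Lemma iid_sum_law (d : measure_display) (T : measurableType d)
    (R : realType) (P : probability T R) (I : choiceType)
    (Y : I -> {RV P >-> R}) (H : probability R R) : iid_with_law Y H ->
  forall (s : seq I) (B : set R), uniq s -> measurable B ->
  P [set w | B (\sum_(i <- s) Y i w)] = conv_pow H (size s) B.
Proof.
move=> iidY s B us mB.
have := @iid_sum_cylinder _ _ _ _ _ _ _ iidY s fset0 (fun=> setT) B us.
rewrite big_seq_fset0 mule1 => <-//; congr (P _).
by apply/seteqP; split => [w Bw|w []//]; split => // i.
Qed.

Lemma iid_joint_law (d : measure_display) (T : measurableType d)
    (R : realType) (P : probability T R) (I : choiceType)
    (Y : I -> {RV P >-> R}) (H : probability R R) : iid_with_law Y H ->
  forall (j : I) (s : seq I) (C : set (R * R)), uniq s -> j \notin s ->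
  measurable C ->
  P [set w | C (Y j w, \sum_(i <- s) Y i w)] =
  (H \x conv_pow H (size s))%E C.
Proof.
move=> iidY j s C us js mC.
rewrite -[X in P X]setIT (@restricted_joint_law _ _ _ P _ _ _ 1%:nng H
  (conv_pow H (size s)))// ?mul1e//.
- exact: measurable_partial_sum.
move=> A B mA mB.
have := @iid_sum_cylinder _ _ _ _ _ _ _ iidY s [fset j]%fset (fun=> A) B us.
rewrite big_seq_fset1 muleC mul1e => <-//; last first.
  by move=> i si; rewrite inE; apply: contraNneq js => <-.
congr (P _); apply/seteqP; split => w.
  by move=> [[Yj Sw] _]; split => // i; rewrite /= inE => /eqP ->.
by move=> [Sw Yj]; split => //; split => //; apply: Yj; rewrite /= inE.
Qed.

(** * Tails of convolutions and the event that two summands are large *)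

Lemma EFin_tail (R : realType) (H : probability R R) (x : R) :
  (tail H x)%:E = H `]x, +oo[%classic.
Proof. by rewrite fineK// fin_num_measure. Qed.

Lemma tail_ge0 (R : realType) (H : probability R R) (x : R) : 0 <= tail H x.
Proof. by rewrite fine_ge0. Qed.

Lemma tail_le1 (R : realType) (H : probability R R) (x : R) : tail H x <= 1.
Proof. by rewrite -lee_fin EFin_tail probability_le1. Qed.

Lemma le_tail (R : realType) (H : probability R R) (x y : R) :
  x <= y -> tail H y <= tail H x.
Proof.
move=> xy; rewrite -lee_fin !EFin_tail le_measure ?inE// => z /=.
by rewrite !in_itv/= !andbT; exact: le_lt_trans.
Qed.

Lemma eq_tail (R : realType) (H G : probability R R) (x : R) :
  same_law H G -> tail H x = tail G x.
Proof. by move=> HG; rewrite /tail HG. Qed.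

Lemma tail_lt0 (R : realType) (H : probability R R) (x : R) :
  H `[0, +oo[%classic = 1%E -> x < 0 -> tail H x = 1.
Proof.
move=> H0 x0; apply/eqP; rewrite eq_le tail_le1/= -lee_fin EFin_tail -H0.
rewrite le_measure ?inE// => z /=.
by rewrite !in_itv/= !andbT; exact: lt_le_trans.
Qed.

Lemma tail_convE (R : realType) (H G : probability R R) (x : R) :
  (tail (conv H G) x)%:E = (\int[H]_a (tail G (x - a))%:E)%E.
Proof.
rewrite EFin_tail convE; apply: eq_integral => a _; rewrite EFin_tail.
by congr (G _); apply/seteqP; split => b /=; rewrite !in_itv/= !andbT ltrBlDl.
Qed.

Lemma tail_mul_le_conv (R : realType) (H G : probability R R) (a b : R) :
  tail H a * tail G b <= tail (conv H G) (a + b).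
Proof.
rewrite -lee_fin EFinM !EFin_tail.
rewrite -(product_measure1E H G)//; apply: le_measure; rewrite ?inE//.
- exact: measurableX.
- exact: measurable_funPTI.
- move=> [u v] /= []; rewrite !in_itv/= !andbT /pair_sum/=; exact: ltrD.
Qed.

Lemma tail_le_conv (R : realType) (H G : probability R R) (x : R) :
  H `[0, +oo[%classic = 1%E -> tail G x <= tail (conv H G) x.
Proof.
move=> H0; rewrite -lee_fin !EFin_tail -[leLHS]mul1e -H0.
rewrite -(product_measure1E H G)//; apply: le_measure; rewrite ?inE//.
- exact: measurableX.
- exact: measurable_funPTI.
- move=> [u v] /= []; rewrite !in_itv/= !andbT /pair_sum/=.
  by move=> u0 xv; rewrite ltr_wpDl.
Qed.

Lemma le_tail_conv_pow (R : realType) (H : probability R R) (m n : nat) (x : R) :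
  H `[0, +oo[%classic = 1%E -> (m <= n)%N ->
  tail (conv_pow H m) x <= tail (conv_pow H n) x.
Proof.
move=> H0 /subnK <-; elim: (n - m)%N => // k IH.
exact: le_trans IH (tail_le_conv _ _ H0).
Qed.

Lemma tail_conv_pow0 (R : realType) (H : probability R R) (x : R) :
  0 <= x -> tail (conv_pow H 0) x = 0.
Proof.
move=> x0; apply: EFin_inj; rewrite EFin_tail [LHS]diracE memNset//= in_itv/= andbT.
by apply/negP; rewrite -leNgt.
Qed.

(** The set is increasing in both coordinates, hence monotone under comparison
    of tails. *)
Definition both_exceed {R : realType} (K x : R) : set (R * R) :=
  [set ab | [/\ K < ab.1, K < ab.2 & x < ab.1 + ab.2]].

Lemma measurable_both_exceed (R : realType) (K x : R) :
  measurable (both_exceed K x).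
Proof.
have -> : both_exceed K x =
    (`]K, +oo[ `*` `]K, +oo[) `&` (@pair_sum R @^-1` `]x, +oo[).
  apply/seteqP; split => -[a b] /=; rewrite !in_itv/= !andbT.
    by move=> [].
  by move=> [[]].
by apply: measurableI; [exact: measurableX|exact: measurable_funPTI].
Qed.

Lemma both_exceedC (R : realType) (H G : probability R R) (K x : R) :
  (H \x G)%E (both_exceed K x) = (G \x H)%E (both_exceed K x).
Proof.
transitivity ((H \x^ G)%E (both_exceed K x)).
  apply: product_measure_unique => //; last exact: measurable_both_exceed.
  by move=> B C mB' mC; rewrite /= product_measure2E.
apply: eq_integral => a _ /=; congr (H _).
apply/seteqP; split => b; rewrite /ysection/xsection/= !inE /both_exceed/=.
  by rewrite addrC => -[].
by rewrite addrC => -[].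
Qed.

(** The section of the set at a is empty or the half-line above
    max (k, x - a), so its measure is a tail. *)
Lemma both_exceed_dominated (R : realType) (H G K : probability R R)
    (C k x : R) : (forall y, tail G y <= C * tail K y) -> 0 <= C ->
  ((H \x G) (both_exceed k x) <= C%:E * (H \x K) (both_exceed k x))%E.
Proof.
move=> GK C0; have mB := measurable_both_exceed k x.
rewrite /product_measure1 -ge0_integralZl//; last exact: measurable_fun_xsection.
apply: ge0_le_integral => //.
- exact: measurable_fun_xsection.
- by apply: measurable_funeM; exact: measurable_fun_xsection.
move=> a _ /=.
have [ka|ka] := ltP k a.
  have -> : xsection (both_exceed k x) a = `]Num.max k (x - a), +oo[%classic.
    apply/seteqP; split => b; rewrite /xsection/= inE /both_exceed/=;
      rewrite in_itv/= andbT gt_max ltrBlDl.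
      by move=> [_ -> ->].
    by move=> /andP[].
  by rewrite -!EFin_tail -EFinM lee_fin.
rewrite (_ : xsection _ _ = set0) ?measure0 ?mule0//.
apply/seteqP; split => b //; rewrite /xsection/= inE /both_exceed/=.
by move=> [/lt_le_trans/(_ ka)]; rewrite ltxx.
Qed.

Lemma both_exceed_dominated2 (R : realType) (H1 H2 G : probability R R)
    (C1 C2 k x : R) : 0 <= C1 -> 0 <= C2 ->
  (forall y, tail H1 y <= C1 * tail G y) ->
  (forall y, tail H2 y <= C2 * tail G y) ->
  ((H1 \x H2) (both_exceed k x) <= (C1 * C2)%:E * (G \x G) (both_exceed k x))%E.
Proof.
move=> C10 C20 H1G H2G.
apply: le_trans (both_exceed_dominated H1 k x H2G C20) _.
rewrite both_exceedC mulrC EFinM -muleA; apply: lee_wpmul2l => //.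
exact: both_exceed_dominated.
Qed.

Lemma measure_bigcup_seq_le (d : measure_display) (T : measurableType d)
    (R : realType) (P : {measure set T -> \bar R}) (I : choiceType)
    (s : seq I) (A : I -> set T) : (forall i, measurable (A i)) ->
  (P (\bigcup_(i in [set` s]) A i) <= \sum_(i <- s) P (A i))%E.
Proof.
move=> mA; rewrite bigcup_seq; elim: s => [|i s IH].
  by rewrite !big_nil measure0.
rewrite !big_cons; apply: le_trans (leeD2l _ IH).
by apply: measureU2 => //; exact: bigsetU_measurable.
Qed.

Lemma measurable_all_small (d : measure_display) (T : measurableType d)
    (R : realType) (I : choiceType) (Y : I -> {mfun T >-> R}) (s : seq I) (x y : R) :
  measurable [set w | x < \sum_(i <- s) Y i w /\
                      forall i, i \in s -> Y i w <= y].
Proof.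
have -> : [set w | x < \sum_(i <- s) Y i w /\ forall i, i \in s -> Y i w <= y] =
    [set w | x < \sum_(i <- s) Y i w] `&`
    \bigcap_(i in [set` s]) (Y i @^-1` `]-oo, y]).
  apply/seteqP; split => w /= [xS Ys]; split.
  - exact: xS.
  - by move=> i si; rewrite /= in_itv/=; exact: Ys.
  - exact: xS.
  - by move=> i si; have := Ys i si; rewrite /= in_itv.
apply: measurableI; first exact: measurable_sum_gt.
apply: fin_bigcap_measurable => [|i _]; first exact: finite_seq.
exact: measurable_funPTI.
Qed.

(** If the sum exceeds x >= (size s) K then some Y_i exceeds K; when Y_i is at
    most x - K, the sum of the others exceeds K as well. *)
Lemma no_big_jump_le (d : measure_display) (T : measurableType d)
    (R : realType) (P : probability T R) (I : choiceType)
    (Y : I -> {RV P >-> R}) (H : probability R R) (s : seq I) (K x : R) :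
  iid_with_law Y H -> uniq s -> (size s)%:R * K <= x ->
  (P [set w | (x < \sum_(i <- s) Y i w)%R /\
              forall i, i \in s -> (Y i w <= x - K)%R] <=
   (size s)%:R%:E * (H \x conv_pow H (size s).-1) (both_exceed K x))%E.
Proof.
move=> iidY us Kx.
pose A i := [set w | both_exceed K x (Y i w, \sum_(j <- rem i s) Y j w)].
have mA i : measurable (A i).
  rewrite -[X in measurable X]setTI.
  have : measurable_fun setT (fun w => (Y i w, \sum_(j <- rem i s) Y j w)).
    by apply: measurable_fun_pair => //; exact: measurable_partial_sum.
  by apply => //; exact: measurable_both_exceed.
apply: (@le_trans _ _ (P (\bigcup_(i in [set` s]) A i))).
  apply: le_measure; rewrite ?inE.
  - exact: measurable_all_small.
  - by apply: fin_bigcup_measurable => // ; exact: finite_seq.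
  move=> w [xS Ys].
  have [/allP sK|] := boolP (all (fun i => Y i w <= K) s).
    have : \sum_(i <- s) Y i w <= \sum_(i <- s) K.
      by rewrite big_seq [leRHS]big_seq; exact: ler_sum.
    rewrite big_const_seq count_predT iter_addr addr0 -mulr_natl => SK.
    by have := lt_le_trans xS (le_trans SK Kx); rewrite ltxx.
  move=> /allPn[i si]; rewrite -ltNge => KY; exists i => //.
  have SE : \sum_(i <- s) Y i w = Y i w + \sum_(j <- rem i s) Y j w.
    by rewrite (perm_big _ (perm_to_rem si)) big_cons.
  split => //=; last by rewrite -SE.
  by have := Ys i si; move: xS; rewrite SE; lra.
apply: le_trans (measure_bigcup_seq_le _ _ mA) _.
rewrite big_seq (eq_bigr (fun=> (H \x conv_pow H (size s).-1)%E (both_exceed K x))).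
  have c0 : (0 <= (H \x conv_pow H (size s).-1) (both_exceed K x))%E by [].
  rewrite -big_seq; move: (product_measure1 _ _ _) c0 => c c0.
  elim: (s) => [|i s' IH]; first by rewrite big_nil mul0e.
  rewrite big_cons [size _]/= -natr1 EFinD ge0_muleDl// mul1e addeC.
  exact: leeD2r.
move=> i si; rewrite -(size_rem si); apply: iid_joint_law => //.
- exact: rem_uniq.
- by rewrite mem_rem_uniqF.
- exact: measurable_both_exceed.
Qed.

(** * Integer-valued random variables *)

Lemma measurable_nat_event (d : measure_display) (T : measurableType d)
    (M : {mfun T >-> nat}) (A : set nat) : measurable [set w | A (M w)].
Proof. by rewrite -[X in measurable X]setTI; exact: measurable_funP. Qed.

Lemma measurable_addn (d : measure_display) (T : measurableType d)
    (M1 M2 : {mfun T >-> nat}) : measurable_fun setT (fun w => M1 w + M2 w)%N.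
Proof.
move=> _ A _; rewrite setTI.
have -> : (fun w => M1 w + M2 w)%N @^-1` A = \bigcup_i
    ([set w | M1 w = i] `&` [set w | A (i + M2 w)%N]).
  by apply/seteqP; split=> [w Aw|w [i _ [/= <-]]//]; exists (M1 w).
apply: bigcup_measurable => i _; apply: measurableI.
  exact: measurable_nat_event (fun j => j = i).
exact: measurable_nat_event (fun j => A (i + j)%N).
Qed.

Lemma measurable_fun_nat (d : measure_display) (T : measurableType d)
    (R : realType) (M : {mfun T >-> nat}) (h : nat -> \bar R) :
  measurable_fun setT (fun w => h (M w)).
Proof. by move=> _ A _; rewrite setTI; exact: measurable_nat_event (h @^-1` A). Qed.

Lemma integral_nat_split (d : measure_display) (T : measurableType d)
    (R : realType) (P : probability T R) (M : {RV P >-> nat}) (D : set T)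
    (phi : T -> \bar R) : measurable D -> measurable_fun setT phi ->
  (forall w, 0 <= phi w)%E ->
  (\int[P]_(w in D) phi w =
   \sum_(n <oo) \int[P]_(w in D `&` [set w | M w = n]) phi w)%E.
Proof.
move=> mD mphi phi0.
have DE : D = \bigcup_n (D `&` [set w | M w = n]).
  by apply/seteqP; split => [w Dw|w [n _ []]//]; exists (M w).
rewrite {1}DE ge0_integral_bigcup//.
- move=> n; apply: measurableI => //.
  exact: measurable_nat_event (fun j => j = n).
- exact: measurable_funTS.
- apply/trivIsetP => i j _ _ ij; apply/seteqP; split => w //.
  by move=> [[_ /= Mi] [_ /= Mj]]; rewrite -Mi -Mj eqxx in ij.
Qed.

(** Restricting to an event D makes the lemma usable conditionally on another
    variable. *)
Lemma integral_nat_rv (d : measure_display) (T : measurableType d)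
    (R : realType) (P : probability T R) (M : {RV P >-> nat}) (D : set T)
    (h : nat -> \bar R) : measurable D -> (forall n, 0 <= h n)%E ->
  (\int[P]_(w in D) h (M w) =
   \sum_(n <oo) P (D `&` [set w | M w = n]) * h n)%E.
Proof.
move=> mD h0; rewrite (integral_nat_split M)//; last exact: measurable_fun_nat.
apply: eq_eseriesr => n _.
transitivity (\int[P]_(w in D `&` [set w | M w = n]) h n)%E.
  by apply: eq_integral => w; rewrite inE => -[_ /= ->].
have mF : measurable (D `&` [set w | M w = n]).
  by apply: measurableI => //; exact: measurable_nat_event (fun j => j = n).
by rewrite integral_cst// muleC.
Qed.

Lemma probability_nat_split (d : measure_display) (T : measurableType d)
    (R : realType) (P : probability T R) (M : {RV P >-> nat}) (D : set T) :
  measurable D -> (P D = \sum_(n <oo) P (D `&` [set w | M w = n]))%E.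
Proof.
move=> mD; rewrite -[LHS]mul1e -integral_cst//.
rewrite (integral_nat_rv M (h := fun=> 1%E))//.
by apply: eq_eseriesr => n _; rewrite mule1.
Qed.

Section layer_cake.
Context (R : realType) (f : nat -> R).
Hypotheses (f0 : f 0 = 0) (fS : forall k, f k <= f k.+1).

Let increment_ge0 k : (0 <= (f k.+1 - f k)%:E)%E.
Proof. by rewrite lee_fin subr_ge0. Qed.

(** Telescoping; the infinite range makes the sum exchangeable with integrals. *)
Lemma nneseries_increment (n : nat) :
  (\sum_(k <oo) (if (k < n)%N then (f k.+1 - f k)%:E else 0%E) = (f n)%:E)%E.
Proof.
rewrite (nneseries_split _ n); last by move=> k _; case: ifP.
rewrite add0n eseries0 => [|k nk _]; last by rewrite ltnNge nk.
rewrite adde0; elim: n => [|n IH]; first by rewrite big_geq// f0.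
rewrite big_nat_recr//= ltnSn -[RHS]/((f n.+1)%:E).
rewrite (eq_big_nat _ _ (F2 := fun k => if (k < n)%N then (f k.+1 - f k)%:E else 0%E)).
  by rewrite IH -EFinD; congr EFin; ring.
by move=> k /andP[_ kn]; rewrite kn (ltn_trans kn).
Qed.

(** Exchange the integral with the telescoping series for f (M w). *)
Lemma layer_cake (d : measure_display) (T : measurableType d)
    (P : probability T R) (M : {RV P >-> nat}) :
  (\int[P]_w (f (M w))%:E =
   \sum_(k <oo) (f k.+1 - f k)%:E * P [set w | (k < M w)%N])%E.
Proof.
under eq_integral do rewrite -nneseries_increment.
rewrite integral_nneseries//; last 2 first.
- move=> k; exact: (@measurable_fun_nat _ _ _ M
    (fun n => if (k < n)%N then (f k.+1 - f k)%:E else 0%E)).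
- by move=> k w _; case: ifP.
apply: eq_eseriesr => k _.
have mk : measurable [set w | (k < M w)%N] 
  by exact: measurable_nat_event (fun n => (k < n)%N).
rewrite -[in RHS](setIT [set _ | _]) -integral_indic// -ge0_integralZl//; last first.
  by apply/measurable_EFinP; exact: measurable_indic.
apply: eq_integral => w _; rewrite indicE; case: ifPn => kM.
  by rewrite mem_set// mule1.
by rewrite memNset ?mule0//; exact/negP.
Qed.

End layer_cake.

(** Partial sums are measurable for the sigma-algebra generated by the family,
    to which the independence of N and the family refers. *)
Lemma partial_sum_in_family (d : measure_display) (T : measurableType d)
    (R : realType) (X : nat -> {mfun T >-> R}) (n : nat) (B : set R) :
  measurable B -> sigma_of_family X [set w | B (\sum_(i < n) X i w)].
Proof.
move=> mB.
pose G := \bigcup_i sigma_of (X i).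
have mX i : measurable_fun (setT : set (g_sigma_algebraType G)) (X i).
  move=> _ A mA; apply: sub_gen_smallest; exists i => //.
  by exists A.
have : measurable_fun (setT : set (g_sigma_algebraType G))
    (fun w => \sum_(i < n) X i w) by exact: measurable_sum.
by move=> /(_ measurableT B mB); rewrite setTI.
Qed.

Lemma random_sum_mixture (d : measure_display) (T : measurableType d)
    (R : realType) (P : probability T R) (F : probability R R)
    (X : nat -> {RV P >-> R}) (N : {RV P >-> nat}) (A : set R) :
  iid_with_law X F ->
  independent_systems P (sigma_of N) (sigma_of_family X) -> measurable A ->
  (random_sum_law X N A = \sum_(n <oo) P [set w | N w = n] * conv_pow F n A)%E.
Proof.
move=> iidX indN mA.
have mD : measurable (random_sum X N @^-1` A) by exact: measurable_funPTI.
rewrite [LHS](probability_nat_split N mD); apply: eq_eseriesr => n _.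
transitivity (P ([set w | N w = n] `&` [set w | A (\sum_(i < n) X i w)])).
  congr (P _); apply/seteqP; split => w /= [].
    by rewrite /random_sum => + NE; rewrite NE.
  by move=> NE; rewrite /random_sum NE.
rewrite indN//; last 2 first.
- by exists [set n]; rewrite ?setTI.
- exact: partial_sum_in_family.
congr (_ * _)%E.
have := iid_sum_law iidX (iota_uniq 0 n) mA.
rewrite size_iota => <-; congr (P _).
by apply/seteqP; split => w /=;
  rewrite -(big_mkord xpredT (fun i => X i w)) /index_iota subn0.
Qed.

(** * Tails of random sums *)

Lemma integral_add_nat_rv (d : measure_display) (T : measurableType d)
    (R : realType) (P : probability T R) (M1 M2 : {RV P >-> nat})
    (h : nat -> \bar R) :
  independent_systems P (sigma_of M1) (sigma_of M2) ->
  (forall n, 0 <= h n)%E ->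
  (\int[P]_w h (M1 w + M2 w)%N =
   \sum_(i <oo) P [set w | M1 w = i] *
     \sum_(j <oo) P [set w | M2 w = j] * h (i + j)%N)%E.
Proof.
move=> ind h0.
rewrite (integral_nat_split M1)//; last first.
  by move=> _ A _; exact: (measurable_addn M1 M2 measurableT (Y := h @^-1` A)).
apply: eq_eseriesr => i _; rewrite setTI.
transitivity (\int[P]_(w in [set w | M1 w = i]) h (i + M2 w)%N)%E.
  by apply: eq_integral => w; rewrite inE => /= ->.
rewrite (integral_nat_rv M2 (h := fun j => h (i + j)%N))//; last first.
  exact: measurable_nat_event (fun j => j = i).
transitivity (\sum_(j <oo) (fine (P [set w | M1 w = i]))%:E *
    (P [set w | M2 w = j] * h (i + j)%N))%E.
  apply: eq_eseriesr => j _; rewrite muleA fineK; last first.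
    by rewrite fin_num_measure//; exact: measurable_nat_event (fun j => j = i).
  congr (_ * _)%E; apply: ind.
    by exists [set i]; rewrite ?setTI.
  by exists [set j]; rewrite ?setTI.
rewrite nneseriesZl; last by move=> j _; rewrite mule_ge0.
rewrite fineK// fin_num_measure//; exact: measurable_nat_event (fun j => j = i).
Qed.

Section random_sum.
Context (R : realType)
  (d : measure_display) (T : measurableType d) (P : probability T R)
  (F : probability R R) (X : nat -> {RV P >-> R}) (N : {RV P >-> nat})
  (d' : measure_display) (T' : measurableType d') (P' : probability T' R)
  (N1 N2 : {RV P' >-> nat}).
Hypotheses (F0 : F `[0, +oo[%classic = 1%E) (iidX : iid_with_law X F)
  (indN : independent_systems P (sigma_of N) (sigma_of_family X))
  (lawN1 : same_law (distribution P' N1) (distribution P N))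
  (lawN2 : same_law (distribution P' N2) (distribution P N))
  (ind12 : independent_systems P' (sigma_of N1) (sigma_of N2)).

Local Notation G := (random_sum_law X N).
Local Notation f x := (fun n => tail (conv_pow F n) x).

Let f_incr x k : f x k <= f x k.+1.
Proof. exact: tail_le_conv. Qed.

(** Condition on the number of summands, then sum by parts.  The law of N is
    expressed through its copy N1 so that both series live on one space. *)
Lemma tail_random_sum (x : R) : 0 <= x ->
  ((tail G x)%:E =
   \sum_(k <oo) (f x k.+1 - f x k)%:E * P' [set w | (k < N1 w)%N])%E.
Proof.
move=> x0; rewrite EFin_tail (random_sum_mixture iidX indN)//.
rewrite -(layer_cake (tail_conv_pow0 F x0) (f_incr x) N1).
rewrite (integral_nat_rv N1 (h := fun n => (f x n)%:E))//; last first.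
  by move=> n; rewrite lee_fin tail_ge0.
apply: eq_eseriesr => n _; rewrite EFin_tail setTI.
by congr (_ * _)%E; rewrite -[LHS](lawN1 (A := [set n])).
Qed.

(** The square of a mixture of the F_i with weights p_i is the mixture of the
    F_(i+j) with weights p_i p_j, that is the law of a sum of N1 + N2 steps. *)
Lemma tail_conv_random_sum (x : R) : 0 <= x ->
  ((tail (conv_pow G 2) x)%:E =
   \sum_(k <oo) (f x k.+1 - f x k)%:E * P' [set w | (k < N1 w + N2 w)%N])%E.
Proof.
move=> x0; rewrite EFin_tail.
pose M : {RV P' >-> nat} :=
  HB.pack (fun w => N1 w + N2 w)%N
    (isMeasurableFun.Build _ _ _ _ _ (measurable_addn N1 N2)).
rewrite -(layer_cake (tail_conv_pow0 F x0) (f_incr x) M).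
rewrite (integral_add_nat_rv (h := fun n => (f x n)%:E) ind12)//; last first.
  by move=> n; rewrite lee_fin tail_ge0.
have mix A : measurable A ->
    (G A = \sum_(n <oo) P' [set w | N1 w = n] * conv_pow F n A)%E.
  move=> mA; rewrite (random_sum_mixture iidX indN)//.
  by apply: eq_eseriesr => n _; congr (_ * _)%E; rewrite -[LHS](lawN1 (A := [set n])).
have mix2 A : measurable A ->
    (G A = \sum_(n <oo) P' [set w | N2 w = n] * conv_pow F n A)%E.
  move=> mA; rewrite (random_sum_mixture iidX indN)//.
  by apply: eq_eseriesr => n _; congr (_ * _)%E; rewrite -[LHS](lawN2 (A := [set n])).
have GG : same_law (conv_pow G 2) (conv G G).
  by apply: eq_conv => //; exact: conv_pow1.
rewrite GG// (conv_mixture _ _ mix)//; apply: eq_eseriesr => i _.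
rewrite conv_comm// (conv_mixture _ _ mix2)//; congr (_ * _)%E.
by apply: eq_eseriesr => j _; rewrite conv_powD// EFin_tail.
Qed.

(** Keep the first n terms of the series for the tail of G and bound each
    weight P(N > k) below by P(N > n). *)
Lemma tail_conv_pow_le_random_sum (n : nat) (x : R) : 0 <= x ->
  fine (P' [set w | (n < N1 w)%N]) * tail (conv_pow F n) x <= tail G x.
Proof.
move=> x0.
have mN k : measurable [set w | (k < N1 w)%N].
  exact: measurable_nat_event (fun n => (k < n)%N).
rewrite -lee_fin tail_random_sum// EFinM.
rewrite -(nneseries_increment (tail_conv_pow0 F x0) (f_incr x)).
rewrite -nneseriesZl; last by move=> k _; case: ifP => // _; rewrite lee_fin subr_ge0.
apply: lee_nneseries => [k _ _|k _].
  apply: mule_ge0; first by rewrite lee_fin fine_ge0.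
  by case: ifP => // _; rewrite lee_fin subr_ge0.
case: ifPn => kn; last by rewrite mule0 mule_ge0// lee_fin subr_ge0.
rewrite muleC fineK ?fin_num_measure//; apply: lee_wpmul2l.
  by rewrite lee_fin subr_ge0.
apply: le_measure; rewrite ?inE// => w /=; exact: ltn_trans.
Qed.

(** For k >= n0 the weights P(N1 + N2 > k) absorb b P(N > k); for k < n0 the
    weight b P(N > k) is at most b, and these increments add up to the tail of
    the n0-fold convolution. *)
Lemma random_sum_le_conv_pow (n0 : nat) (b c x : R) : 0 <= x -> 0 <= b ->
  (forall n, (n0 <= n)%N ->
     (b%:E * P' [set w | (n < N1 w)%N] <= P' [set w | (n < N1 w + N2 w)%N])%E) ->
  tail (conv_pow G 2) x <= c * tail G x ->
  (b - c) * tail G x <= b * tail (conv_pow F n0) x.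
Proof.
move=> x0 b0 bN G2.
suff : b * tail G x <= tail (conv_pow G 2) x + b * tail (conv_pow F n0) x by lra.
have mN k : measurable [set w | (k < N1 w)%N].
  exact: measurable_nat_event (fun n => (k < n)%N).
have d0 k : (0 <= (f x k.+1 - f x k)%:E)%E by rewrite lee_fin subr_ge0.
rewrite -lee_fin EFinD !EFinM tail_random_sum// tail_conv_random_sum//.
rewrite -(nneseries_increment (tail_conv_pow0 F x0) (f_incr x)).
rewrite -!nneseriesZl; last 2 first.
- by move=> k _; rewrite mule_ge0.
- by move=> k _; case: ifP.
rewrite -nneseriesD; last 2 first.
- by move=> k _ _; rewrite mule_ge0.
- by move=> k _ _; apply: mule_ge0; [rewrite lee_fin|case: ifP].
apply: lee_nneseries => [k _ _|k _].
  by rewrite mule_ge0 ?lee_fin// mule_ge0.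
have [kn|nk] := ltnP k n0.
  apply: le_trans (leeDr _ _); last by rewrite mule_ge0.
  rewrite -[leRHS]mule1 -muleA; apply: lee_wpmul2l; first by rewrite lee_fin.
  by apply: lee_wpmul2l => //; exact: probability_le1.
by rewrite mule0 adde0 muleCA; apply: lee_wpmul2l => //; exact: bN.
Qed.

End random_sum.

(** * Bounds at infinity *)

Section limf.
Context (T : choiceType) (X : filteredType T) (R : realType).
Implicit Types (F : set_system X) (u : X -> \bar R).

Lemma limf_esup_lt_near F u (a : \bar R) : Filter F ->
  (limf_esup u F < a)%E -> \forall x \near F, (u x <= a)%E.
Proof.
move=> FF; rewrite limf_esupE => /ereal_inf_lt[_ [V FV <-] supV].
apply: filterS FV => x Vx; apply: le_trans (ltW supV).
by apply: ereal_sup_ubound; exists x.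
Qed.

Lemma limf_esup_le_near F u (a : \bar R) : Filter F ->
  (\forall x \near F, (u x <= a)%E) -> (limf_esup u F <= a)%E.
Proof.
move=> FF ua; rewrite limf_esupE.
apply: (@le_trans _ _ (ereal_sup (u @` [set x | (u x <= a)%E]))).
  by apply: ereal_inf_lbound; exists [set x | (u x <= a)%E].
by apply: ge_ereal_sup => _ [x /= xa <-].
Qed.

Lemma limf_einf_gt_near F u (a : \bar R) : Filter F ->
  (a < limf_einf u F)%E -> \forall x \near F, (a <= u x)%E.
Proof.
move=> FF; rewrite /limf_einf lteNr => /limf_esup_lt_near.
by apply: filterS => x; rewrite leeN2.
Qed.

Lemma limf_einf_ge_near F u (a : \bar R) : Filter F ->
  (\forall x \near F, (a <= u x)%E) -> (a <= limf_einf u F)%E.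
Proof.
move=> FF ua; rewrite /limf_einf leeNr; apply: limf_esup_le_near.
by apply: filterS ua => x; rewrite leeN2.
Qed.

Lemma limf_einf_le_near F u (a : \bar R) : ProperFilter F ->
  (\forall x \near F, (u x <= a)%E) -> (limf_einf u F <= a)%E.
Proof.
move=> FF ua; rewrite leNgt; apply/negP => /[dup] aF.
rewrite limf_einfE => /ereal_sup_gt[_ [V FV <-] infV].
have [x [Vx ux]] := filter_ex (filterI FV ua).
have : (ereal_inf (u @` V) <= u x)%E by apply: ereal_inf_lbound; exists x.
by move=> /(lt_le_trans infV)/lt_le_trans/(_ ux); rewrite ltxx.
Qed.

End limf.

Lemma near_pinfty_ex (R : realType) (Q : R -> Prop) :
  (\forall x \near +oo, Q x) -> exists x0, forall x, x0 <= x -> Q x.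
Proof.
move=> [M [_ MQ]]; exists (M + 1) => x Mx; apply: MQ.
by apply: lt_le_trans Mx; rewrite ltrDl.
Qed.

Lemma near_pinfty_ge_ex (R : realType) (Q : R -> Prop) (x0 : R) :
  (forall x, x0 <= x -> Q x) -> \forall x \near +oo, Q x.
Proof. by move=> Qx; exists x0; split => [|x /ltW]; [exact: num_real|exact: Qx]. Qed.

Lemma tail_vanishes (R : realType) (H : probability R R) (e : R) :
  0 < e -> exists K, forall x, K <= x -> tail H x <= e.
Proof.
move=> e0.
pose X : {RV H >-> R} := HB.pack (@idfun R)
  (isMeasurableFun.Build _ _ _ _ _ (@measurable_id _ R setT)).
have /fine_cvgP[_] := cvg_ccdfy0 X.
move=> /cvgrPdist_le/(_ e e0)/near_pinfty_ex[K HK].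
exists K => x /HK; rewrite sub0r normrN; apply: le_trans.
exact: ler_norm.
Qed.

(** On the left of x0 the tail of G is at least tail G x0 > 0, so that a larger
    constant works there. *)
Lemma tail_dominated_near (R : realType) (H G : probability R R) (C x0 : R) :
  class_F G -> (forall x, x0 <= x -> tail H x <= C * tail G x) ->
  exists2 C', 0 <= C' & forall x, tail H x <= C' * tail G x.
Proof.
move=> [_ Gpos] HG; exists (Num.max C (tail G x0)^-1).
  by rewrite le_max invr_ge0 tail_ge0 orbT.
move=> x; have [x0x|xx0] := leP x0 x.
  apply: le_trans (HG _ x0x) _; apply: ler_wpM2r; first exact: tail_ge0.
  by rewrite le_max lexx.
apply: le_trans (tail_le1 _ _) _.
apply: (@le_trans _ _ ((tail G x0)^-1 * tail G x)).
  by rewrite ler_pdivlMl// mulr1 le_tail// ltW.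
by apply: ler_wpM2r; [exact: tail_ge0|rewrite le_max lexx orbT].
Qed.

Lemma asymp_equiv_bounds (R : realType) (f g : R -> R) (C x0 : R) :
  0 < C -> (forall x, x0 <= x -> [/\ 0 < g x, f x <= C * g x & g x <= C * f x]) ->
  asymp_equiv f g.
Proof.
move=> C0 fg; split.
  apply: (@lt_le_trans _ _ (C^-1)%:E); first by rewrite lte_fin invr_gt0.
  apply: limf_einf_ge_near; apply: (@near_pinfty_ge_ex _ _ x0) => x /fg[g0 _ gC].
  by rewrite lee_fin ler_pdivlMr// ler_pdivrMl.
apply: (@le_lt_trans _ _ C%:E); last exact: ltry.
apply: limf_esup_le_near; apply: (@near_pinfty_ge_ex _ _ x0) => x /fg[g0 fC _].
by rewrite lee_fin ler_pdivrMr.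
Qed.

Lemma limsup_conv_ratio_bound (R : realType) (G : probability R R) (c : R) :
  class_F G -> (limsup_conv_ratio G < c%:E)%E ->
  exists x0, forall x, x0 <= x -> tail (conv_pow G 2) x <= c * tail G x.
Proof.
move=> [_ Gpos] /limf_esup_lt_near/near_pinfty_ex[x0 Hx0].
exists x0 => x /Hx0; rewrite lee_fin ler_pdivrMr//.
Qed.

(** * The class J in terms of the absence of a big jump *)

(** Complementation inside the event that the sum exceeds x, which replaces the
    extended maximum by a condition on each summand. *)
Lemma probability_big_jump (d : measure_display) (T : measurableType d)
    (R : realType) (P : probability T R) (n : nat) (Y : 'I_n -> {RV P >-> R})
    (K x : R) :
  fine (P [set w |
     ((x - K)%:E < \big[maxe/-oo]_(i < n) (Y i w)%:E)%E /\
     x < \sum_(i < n) Y i w]) =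
  fine (P [set w | x < \sum_(i < n) Y i w]) -
  fine (P [set w | x < \sum_(i <- enum 'I_n) Y i w /\
                   forall i, i \in enum 'I_n -> Y i w <= x - K]).
Proof.
set A := (X in fine (P X) = _); set B := (X in _ = fine (P X) - _).
set E := (X in _ - fine (P X)).
have mE : measurable E by exact: measurable_all_small.
have mB : measurable B by exact: measurable_sum_gt.
have jumpP w : ((x - K)%:E < \big[maxe/-oo]_(i < n) (Y i w)%:E)%E <->
    ~ forall i, i \in enum 'I_n -> Y i w <= x - K.
  rewrite ltNge; split.
    move=> /negP + Ys; apply; apply/bigmax_leP; split; first exact: leNye.
    by move=> i _; rewrite lee_fin; apply: Ys; rewrite mem_enum.
  move=> nYs; apply/negP => /bigmax_leP[_ Ys]; apply: nYs => i _.
  by rewrite -lee_fin; exact: Ys.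
have -> : A = B `\` E.
  apply/seteqP; split => w.
    by move=> [/jumpP nYs xS]; split => // -[_ Ys]; exact: nYs.
  move=> [xS nE]; split => //; apply/jumpP => Ys; apply: nE; split => //.
  by rewrite big_enum.
have EB : E `<=` B by move=> w [+ _]; rewrite /B/= big_enum.
have := measureDI P mB mE; rewrite (setIidr EB) => ->.
by rewrite fineD ?fin_num_measure//; [rewrite addrK|exact: measurableD].
Qed.

(** A concrete pair on which the property J can be evaluated. *)
Lemma iid_product_pair (R : realType) (G : probability R R) :
  exists Y : 'I_2 -> {RV (G \x G)%E >-> R},
    [/\ iid_with_law Y G, (forall w, Y ord0 w = w.1) &
        (forall w, Y ord_max w = w.2)].
Proof.
pose X1 : {mfun (R * R)%type >-> R} := HB.pack (@fst R R)
  (isMeasurableFun.Build _ _ _ _ _ (@measurable_fst _ _ R R)).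
pose X2 : {mfun (R * R)%type >-> R} := HB.pack (@snd R R)
  (isMeasurableFun.Build _ _ _ _ _ (@measurable_snd _ _ R R)).
pose Y (i : 'I_2) : {RV (G \x G)%E >-> R} := if i == ord0 then X1 else X2.
have GT : G [set: R] = 1%E by exact: probability_setT.
have YA i A : measurable A -> (G \x G)%E (Y i @^-1` A) = G A.
  move=> mA.
  rewrite /Y; case: ifP => _ /=.
    rewrite (_ : fst @^-1` A = A `*` setT); last by apply/seteqP; split => w /=; [|case].
    rewrite product_measure1E// -[RHS]mule1; congr (_ * _)%E; exact: GT.
  rewrite (_ : snd @^-1` A = setT `*` A); last by apply/seteqP; split => w /=; [|case].
  rewrite product_measure1E// -[RHS]mul1e; congr (_ * _)%E; exact: GT.
exists Y; split => //; split; last by move=> i A; exact: YA.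
move=> J A mA.
(* padding with the full space turns an arbitrary subfamily into a rectangle *)
pose A' i := if i \in J then A i else setT.
have mA' i : measurable (A' i) by rewrite /A'; case: ifP.
have -> : \bigcap_(i in [set` J]) (Y i @^-1` A i) = A' ord0 `*` A' ord_max.
  apply/seteqP; split => w.
    move=> Aw; split; rewrite /A'; case: ifP => //= iJ; first exact: (Aw _ iJ).
    exact: (Aw _ iJ).
  move=> [A0 A1] i /= iJ.
  have [i0|i1] := eqVneq i ord0.
    by rewrite /Y i0 eqxx; move: A0; rewrite /A' -i0 iJ.
  rewrite /Y (negbTE i1).
  have im : i = ord_max.
    by apply/val_inj; case: i i1 {iJ} => -[|[|//]] //= ?; rewrite -val_eqE.
  by move: A1; rewrite /A' -im iJ.
transitivity (G (A' ord0) * G (A' ord_max))%E; first exact: product_measure1E.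
transitivity (\prod_(i <- enum [pred i | i \in J]) G (A i))%E; last first.
  transitivity (\prod_(i <- J) G (A i))%E; last first.
    by apply: eq_bigr => i _; exact/esym/YA.
  apply: perm_big; apply: uniq_perm; rewrite ?enum_uniq ?fset_uniq//.
  by move=> i; rewrite mem_enum.
rewrite big_enum/= big_mkcond !big_ord_recl big_ord0/= mule1 /A'.
rewrite (_ : lift ord0 ord0 = ord_max); last exact: val_inj.
by do 2 case: ifP => _; rewrite ?GT.
Qed.

(** * One big jump *)

Lemma tail_partial_sum (d : measure_display) (T : measurableType d)
    (R : realType) (P : probability T R) (I : choiceType)
    (Y : I -> {RV P >-> R}) (H : probability R R) (s : seq I) (x : R) :
  iid_with_law Y H -> uniq s ->
  fine (P [set w | x < \sum_(i <- s) Y i w]) = tail (conv_pow H (size s)) x.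
Proof.
move=> iidY us; rewrite /tail -(iid_sum_law iidY us)//; congr (fine (P _)).
by apply/seteqP; split => w /=; rewrite in_itv/= andbT.
Qed.

Lemma tail_partial_sum_ord (d : measure_display) (T : measurableType d)
    (R : realType) (P : probability T R) (n : nat)
    (Y : 'I_n -> {RV P >-> R}) (H : probability R R) (x : R) :
  iid_with_law Y H ->
  fine (P [set w | x < \sum_(i < n) Y i w]) = tail (conv_pow H n) x.
Proof.
move=> iidY; have := tail_partial_sum x iidY (enum_uniq 'I_n).
rewrite size_enum_ord => <-; congr (fine (P _)).
by apply/seteqP; split => w /=; rewrite big_enum.
Qed.

(** Independent copies exceeding x - K and K have a sum exceeding x. *)
Lemma tail_shift_bound (R : realType) (G : probability R R) (c x0 K : R) :
  class_F G ->
  (forall x, x0 <= x -> tail (conv_pow G 2) x <= c * tail G x) ->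
  forall x, x0 <= x -> tail G (x - K) <= c / tail G K * tail G x.
Proof.
move=> [_ Gpos] Gc x /Gc G2.
rewrite mulrAC ler_pdivlMr//; apply: le_trans G2.
rewrite -{2}(subrK K x); apply: le_trans (tail_mul_le_conv _ _ _ _) _.
by rewrite (eq_tail (G := conv_pow G 2))// => A mA; apply: eq_conv => //;
  apply: same_law_sym; exact: conv_pow1.
Qed.

(** Given that the sum of two independent variables of law G is large, the
    smaller one is tight.  The normalisation by the tail of G, rather than of the
    sum, makes the property stable under replacing G by a law of comparable tail. *)
Definition one_big_of_two (R : realType) (G : probability R R) : Prop :=
  forall e, 0 < e -> exists K x0, forall x, x0 <= x ->
    ((G \x G) (both_exceed K x) <= (e * tail G x)%:E)%E.

(** Property J bounds the event that neither summand exceeds x - K.  On the rest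
    of the event, one summand exceeds x - K and the other K', which has
    probability at most 2 g(x - K) g(K') = O(g(x)) g(K'). *)
Lemma class_J_one_big_of_two (R : realType) (G : probability R R) (c x0 : R) :
  0 < c -> class_J G ->
  (forall x, x0 <= x -> tail (conv_pow G 2) x <= c * tail G x) ->
  one_big_of_two G.
Proof.
move=> c0 [FG JG] Gc e e0; have Gpos := FG.2.
have [Y [iidY Y0 Y1]] := iid_product_pair G.
have := JG 2 isT _ _ _ Y iidY.
set u := (fun K => limf_einf _ _).
(* the total e is split as e/2 + e/4 + e/4; the factor c converts the tail of
   the sum into the tail of G *)
have e'0 : 0 < e / (2 * c) by rewrite divr_gt0// mulr_gt0.
move=> /fine_cvgP[ufin /cvgrPdist_lt/(_ _ e'0) uK].
have [K [{}ufin {}uK]] := filter_ex (filterI ufin uK).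
have : ((1 - e / (2 * c))%:E < u K)%E.
  rewrite -(fineK ufin) lte_fin; have := ler_norm (1 - (fine \o u) K).
  by move=> /le_lt_trans/(_ uK)/=; lra.
move=> /limf_einf_gt_near/near_pinfty_ex[x1 Hx1].
(* K' is chosen after K: the shift by K costs the factor c / tail G K *)
have [K' HK'] : exists K', forall x, K' <= x ->
    tail G x <= e * tail G K / (4 * c).
  by apply: tail_vanishes; rewrite divr_gt0// ?mulr_gt0.
exists K', (Num.max x0 x1) => x; rewrite ge_max => /andP[xx0 xx1].
pose E := [set w | x < \sum_(i <- enum 'I_2) Y i w /\
                   forall i, i \in enum 'I_2 -> Y i w <= x - K].
have mE : measurable E by exact: measurable_all_small.
have G2pos : 0 < tail (conv_pow G 2) x.
  apply: lt_le_trans (Gpos x) _; rewrite -(eq_tail x (conv_pow1 G)).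
  by apply: le_tail_conv_pow => //; exact: FG.1.
have PE : fine ((G \x G)%E E) <= e / 2 * tail G x.
  have := Hx1 _ xx1; rewrite lee_fin probability_big_jump.
  rewrite (tail_partial_sum_ord _ iidY) ler_pdivlMr// -/E.
  move: (fine _) (Gc _ xx0) => p Gx; move: (tail G x) (tail _ x) Gx G2pos => g b Gx b0.
  rewrite mulrBl mul1r => pb.
  have : p <= e / (2 * c) * b by lra.
  move=> /le_trans; apply.
  apply: (@le_trans _ _ (e / (2 * c) * (c * g))).
    by apply: ler_wpM2l => //; exact: ltW.
  by rewrite le_eqVlt; apply/orP; left; apply/eqP; field; lra.
have mI (a : R) : measurable (`]a, +oo[%classic : set R) by [].
have PI : tail G (x - K) * tail G K' <= e / 4 * tail G x.
  have GK := tail_shift_bound K FG Gc xx0.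
  apply: le_trans (ler_pM _ _ GK (HK' _ (lexx _))) _; rewrite ?tail_ge0//.
  rewrite le_eqVlt; apply/orP; left; apply/eqP; field.
  by rewrite !gt_eqF.
pose I1 : set (R * R) := `]x - K, +oo[ `*` `]K', +oo[.
pose I2 : set (R * R) := `]K', +oo[ `*` `]x - K, +oo[.
have mI1 : measurable I1 by exact: measurableX.
have mI2 : measurable I2 by exact: measurableX.
have sub : both_exceed K' x `<=` E `|` I1 `|` I2.
  move=> [a b] [/= aK bK xab].
  have [ax|ax] := ltP (x - K) a; first by left; right; rewrite /I1/= !in_itv/= ax bK.
  have [bx|bx] := ltP (x - K) b; first by right; rewrite /I2/= !in_itv/= bx aK.
  left; left; split.
    rewrite big_enum/= big_ord_recl big_ord_recl big_ord0 addr0.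
    by rewrite (_ : lift ord0 ord0 = ord_max) ?Y0 ?Y1//; exact: val_inj.
  move=> i _; have [->|i1] := eqVneq i ord0; first by rewrite Y0.
  rewrite (_ : i = ord_max) ?Y1//.
  by apply/val_inj; case: i i1 => -[|[|//]] //= ?; rewrite -val_eqE.
have mB := measurable_both_exceed K' x.
apply: (@le_trans _ _ ((G \x G) E + (G \x G) I1 + (G \x G) I2))%E.
  apply: (@le_trans _ _ ((G \x G) (E `|` I1 `|` I2))%E).
    apply: le_measure; rewrite ?inE//.
    by apply: measurableU => //; exact: measurableU.
  apply: le_trans (measureU2 _ _ _) _ => //; first exact: measurableU.
  by apply: leeD2r; exact: measureU2.
have -> : (G \x G)%E I1 = (tail G (x - K) * tail G K')%:E.
  by rewrite EFinM !EFin_tail; exact: product_measure1E.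
have -> : (G \x G)%E I2 = (tail G K' * tail G (x - K))%:E.
  by rewrite EFinM !EFin_tail; exact: product_measure1E.
rewrite -[X in (X + _ + _)%E]fineK; last first.
  exact: (fin_num_measure ((G \x G)%E : probability _ R)).
by rewrite -!EFinD lee_fin; move: PE PI; lra.
Qed.

(** A summand and the sum of the others have laws F and F_n, both of tail O(g),
    so the bound for two variables of law G applies to them.  The constants K and
    x0 depend on the number of summands only, not on the probability space. *)
Lemma no_big_jump_negligible (R : realType) (F G : probability R R) (n : nat)
    (e : R) :
  (forall m, exists2 C, 0 <= C &
     forall y, tail (conv_pow F m) y <= C * tail G y) ->
  one_big_of_two G -> 0 < e ->
  exists K x0, forall (d : measure_display) (T : measurableType d)
    (P : probability T R) (I : choiceType) (Y : I -> {RV P >-> R}) (s : seq I),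
  iid_with_law Y F -> uniq s -> size s = n.+1 ->
  forall x, x0 <= x ->
    fine (P [set w | x < \sum_(i <- s) Y i w /\
                     forall i, i \in s -> Y i w <= x - K]) <= e * tail G x.
Proof.
move=> FG Gtight e0.
have [C1 C10 H1] := FG 1%N; have [C2 C20 H2] := FG n.
have F1 y : tail F y <= C1 * tail G y.
  by rewrite -(eq_tail y (conv_pow1 F)).
(* adding 1 keeps D positive even if a constant vanishes *)
pose D := n.+1%:R * (C1 * C2) + 1.
have D0 : 0 < D by rewrite ltr_wpDl// !mulr_ge0.
have [K [x0 HK]] := Gtight _ (divr_gt0 e0 D0).
exists K, (Num.max x0 (n.+1%:R * K)) => d T P I Y s iidY us ss x.
rewrite ge_max => /andP[xx0 xK].
have mE := measurable_all_small Y s x (x - K).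
rewrite -lee_fin fineK ?fin_num_measure//.
apply: le_trans (no_big_jump_le iidY us _) _; first by rewrite ss.
rewrite ss /=.
apply: (@le_trans _ _ (n.+1%:R%:E * ((C1 * C2)%:E * (e / D * tail G x)%:E))%E).
  apply: lee_wpmul2l => //.
  apply: le_trans (both_exceed_dominated2 _ _ C10 C20 F1 H2) _.
  by apply: lee_wpmul2l; [rewrite lee_fin mulr_ge0|exact: HK].
rewrite -!EFinM lee_fin.
have -> : n.+1%:R * (C1 * C2 * (e / D * tail G x)) =
    e / D * (n.+1%:R * (C1 * C2)) * tail G x by ring.
apply: ler_wpM2r; first exact: tail_ge0.
by rewrite mulrAC ler_pdivrMr// ler_pM2l// lerDl.
Qed.

(** * Comparing the step law with the random sum *)

Lemma ereal_dense (R : realType) (x y : \bar R) :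
  (x < y)%E -> exists r : R, (x < r%:E < y)%E.
Proof.
case: x y => [x| |] [y| |]//=.
- rewrite lte_fin => xy; exists ((x + y) / 2).
  by rewrite !lte_fin !midf_lt.
- by move=> _; exists (x + 1); rewrite lte_fin ltrDl ltr01 ltry.
- by move=> _; exists (y - 1); rewrite lte_fin gtrBl ltr01 ltNyr.
- by move=> _; exists 0; rewrite ltry ltNyr.
Qed.

(** The probability of a large sum without a big jump is at most e g(x), and the
    probability of a large sum is at least tail F x >= g(x) / C. *)
Lemma class_J_of_domination (R : realType) (F G : probability R R) (C : R) :
  class_F F -> class_F G ->
  (forall x, tail G x <= C * tail F x) ->
  (forall m, exists2 C', 0 <= C' &
     forall y, tail (conv_pow F m) y <= C' * tail G y) ->
  one_big_of_two G -> class_J F.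
Proof.
move=> FF FG GF FmG Gtight; split=> // -[//|n] n1 d T P Y iidY.
(* both tails are positive, which forces the sign of C *)
have C0 : 0 < C.
  by have := lt_le_trans (FG.2 0) (GF 0); rewrite pmulr_lgt0// FF.2.
pose q K := ereal_ratio
  (fun x : R => fine (P [set w |
     ((x - K)%:E < \big[maxe/-oo]_(i < n.+1) (Y i w)%:E)%E /\
     x < \sum_(i < n.+1) Y i w]))
  (fun x : R => fine (P [set w | x < \sum_(i < n.+1) Y i w])).
rewrite -/(fun K => limf_einf (q K) +oo%R).
have sE (x : R) : fine (P [set w | x < \sum_(i < n.+1) Y i w]) =
    tail (conv_pow F n.+1) x by exact: tail_partial_sum_ord.
have s_ge x : tail F x <= tail (conv_pow F n.+1) x.
  rewrite -(eq_tail x (conv_pow1 F)).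
  by apply: le_tail_conv_pow => //; exact: FF.1.
have s_gt0 x : 0 < tail (conv_pow F n.+1) x by apply: lt_le_trans (s_ge x); exact: FF.2.
have q_le1 K x : (q K x <= 1%:E)%E.
  rewrite lee_fin ler_pdivrMr ?mul1r; last by rewrite sE.
  by rewrite probability_big_jump gerBl fine_ge0.
have u_le1 K : (limf_einf (q K) +oo%R <= 1%:E)%E.
  by apply: limf_einf_le_near; near=> x; exact: q_le1.
have u_ge e : 0 < e -> exists K0, forall K, K0 <= K ->
    ((1 - e)%:E <= limf_einf (q K) +oo%R)%E.
  move=> e0.
  have [K0 [x0 HK]] := no_big_jump_negligible n FmG Gtight (divr_gt0 e0 C0).
  exists K0 => K K0K; apply: limf_einf_ge_near.
  apply: (@near_pinfty_ge_ex _ _ x0) => x x0x.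
  rewrite lee_fin probability_big_jump sE ler_pdivlMr//.
  rewrite mulrBl mul1r lerD2l lerN2.
  apply: (@le_trans _ _ (e / C * tail G x)).
    apply: le_trans (HK _ _ _ _ _ _ iidY (enum_uniq _) (size_enum_ord _) _ x0x).
    apply: fine_le; rewrite ?fin_num_measure//; try exact: measurable_all_small.
    apply: le_measure; rewrite ?inE; try exact: measurable_all_small.
    move=> w [xS Ys]; split => // i si; apply: le_trans (Ys _ si) _.
    by rewrite lerD2l lerN2.
  rewrite mulrAC ler_pdivrMr// -mulrA; apply: ler_wpM2l; first exact: ltW.
  by apply: le_trans (GF x) _; rewrite mulrC; apply: ler_wpM2r => //; exact: ltW.
apply/fine_cvgP; split.
  have [K0 HK0] := u_ge _ ltr01.
  apply: (@near_pinfty_ge_ex _ _ K0) => K /HK0.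
  rewrite subrr => u0; rewrite fin_numE; apply/andP; split; apply/eqP => uE.
    by rewrite uE in u0.
  by have := u_le1 K; rewrite uE.
apply/cvgrPdist_le => e e0; have [K0 HK0] := u_ge _ e0.
apply: (@near_pinfty_ge_ex _ _ K0) => K /HK0 /=.
have := u_le1 K; case: (limf_einf (q K) _) => [r| |]//=.
by rewrite !lee_fin => r1 r2; rewrite ger0_norm ?subr_ge0//; lra.
Unshelve. all: by end_near. Qed.

Section domination.
Context (R : realType)
  (d : measure_display) (T : measurableType d) (P : probability T R)
  (F : probability R R) (X : nat -> {RV P >-> R}) (N : {RV P >-> nat})
  (d' : measure_display) (T' : measurableType d') (P' : probability T' R)
  (N1 N2 : {RV P' >-> nat}).
Hypotheses (FF : class_F F) (iidX : iid_with_law X F)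
  (indN : independent_systems P (sigma_of N) (sigma_of_family X))
  (N_unbounded : forall n : nat, (0 < P [set w | (n < N w)%N])%E)
  (lawN1 : same_law (distribution P' N1) (distribution P N))
  (lawN2 : same_law (distribution P' N2) (distribution P N))
  (ind12 : independent_systems P' (sigma_of N1) (sigma_of N2)).

Local Notation G := (random_sum_law X N).
Local Notation B n := (P' [set w | (n < N1 w + N2 w)%N]).
Local Notation A n := (P' [set w | (n < N1 w)%N]).

Hypothesis (FG : class_F G).

Lemma N1_tail_gt0 n : 0 < fine (A n).
Proof.
have AE : A n = P [set w | (n < N w)%N].
  exact: (lawN1 (A := [set k | (n < k)%N])).
rewrite fine_gt0// AE N_unbounded/=.
by apply: le_lt_trans (probability_le1 _ _) (ltry _);
  exact: measurable_nat_event (fun k => (n < k)%N).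
Qed.

Lemma conv_pow_dominated (m : nat) :
  exists2 C, 0 <= C & forall y, tail (conv_pow F m) y <= C * tail G y.
Proof.
apply: (@tail_dominated_near _ _ _ (fine (A m))^-1 0) => // x x0.
rewrite ler_pdivlMl ?N1_tail_gt0//.
by apply: tail_conv_pow_le_random_sum => //; exact: FF.1.
Qed.

Hypothesis gap :
  (limsup_conv_ratio G <
   limn_einf (ereal_ratio (fun n : nat => fine (B n)) (fun n => fine (A n))))%E.

(** The constants come from reals c < b inserted in the gap.  Passing from n to
    n.+1 summands only increases the tail and ensures at least one summand. *)
Lemma dominated_by_conv_pow :
  exists c C x0 : R, exists n : nat, [/\ 0 < c, 0 < C, 0 <= x0,
    forall x, x0 <= x -> tail (conv_pow G 2) x <= c * tail G x &
    forall x, x0 <= x -> tail G x <= C * tail (conv_pow F n.+1) x].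
Proof.
have [c /andP[Gc cl]] := ereal_dense gap.
have [b /andP[cb bl]] := ereal_dense cl.
rewrite lte_fin in cb.
have [x1 Hx1] := limsup_conv_ratio_bound FG Gc.
have c0 : 0 < c.
  have := Hx1 _ (lexx x1); have := tail_le_conv G x1 FG.1.
  rewrite (_ : tail (conv_pow G 2) x1 = tail (conv G G) x1); last first.
    by apply: eq_tail; apply: eq_conv => //; exact: conv_pow1.
  by move=> /le_trans/[apply]; rewrite ler_pMl ?FG.2//; exact: lt_le_trans.
have b0 : 0 < b by exact: lt_trans cb.
have [n0 _ Hn0] := limf_einf_gt_near _ bl.
exists c, (b / (b - c)), (Num.max 0 x1), n0; split => //.
- by rewrite divr_gt0// subr_gt0.
- by rewrite le_max lexx.
- by move=> x; rewrite ge_max => /andP[_]; exact: Hx1.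
move=> x; rewrite ge_max => /andP[x0 xx1].
rewrite mulrAC ler_pdivlMr ?subr_gt0// mulrC.
apply: (@le_trans _ _ (b * tail (conv_pow F n0) x)); last first.
  apply: ler_wpM2l; first exact: ltW.
  by apply: tail_le_conv; exact: FF.1.
have := random_sum_le_conv_pow FF.1 iidX indN lawN1 lawN2 ind12 x0 (ltW b0) _ (Hx1 _ xx1).
apply => n nn0; have := Hn0 n nn0.
rewrite lee_fin ler_pdivlMr ?N1_tail_gt0// => bAB.
rewrite -[X in (_ * X <= _)%E]fineK; last first.
  by rewrite fin_num_measure//; exact: measurable_nat_event (fun k => (n < k)%N).
rewrite -[X in (_ <= X)%E]fineK ?lee_fin//.
rewrite fin_num_measure//.
have := measurable_addn N1 N2 measurableT (Y := [set k | (n < k)%N]).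
by rewrite setTI; apply.
Qed.

Lemma random_sum_asymp_conv_pow :
  exists m : nat, (0 < m)%N /\ asymp_equiv (tail (conv_pow F m)) (tail G).
Proof.
have [c [C [x0 [n [_ C0 _ _ GF]]]]] := dominated_by_conv_pow.
exists n.+1; split => //.
have [C' C'0 FG'] := conv_pow_dominated n.+1.
apply: (@asymp_equiv_bounds _ _ _ (Num.max C C') x0); first by rewrite lt_max C0.
move=> x xx0; split; first exact: FG.2.
  by apply: le_trans (FG' x) _; apply: ler_wpM2r; rewrite ?tail_ge0// le_max lexx orbT.
by apply: le_trans (GF x xx0) _; apply: ler_wpM2r; rewrite ?tail_ge0// le_max lexx.
Qed.

(** With precision 1 / (2 C), the event without a big jump contributes at most
    half of tail G x to C f_(n+1)(x), so the event that one of n + 1 steps exceeds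
    x - K contributes the other half.  The shift by K is removed by
    [tail_shift_bound]. *)
Lemma class_J_dominated_by_step : class_J G ->
  one_big_of_two G /\ exists2 C, 0 <= C & forall x, tail G x <= C * tail F x.
Proof.
move=> JG; have [c [C [x0 [n [c0 C0 x00 G2 GF]]]]] := dominated_by_conv_pow.
have tightG := class_J_one_big_of_two c0 JG G2.
split => //.
have e0 : 0 < (2 * C)^-1 by rewrite invr_gt0 mulr_gt0.
have [K [x1 HK]] := no_big_jump_negligible n conv_pow_dominated tightG e0.
pose s := iota 0 n.+1.
have us : uniq s by exact: iota_uniq.
have ss : size s = n.+1 by exact: size_iota.
have jump x : tail (conv_pow F n.+1) x <=
    fine (P [set w | x < \sum_(i <- s) X i w /\
                     forall i, i \in s -> X i w <= x - K]) +
    n.+1%:R * tail F (x - K).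
  set E := [set w | _].
  have mE : measurable E by exact: measurable_all_small.
  rewrite -[in leLHS]ss -(tail_partial_sum x iidX us).
  rewrite -lee_fin EFinD fineK ?fin_num_measure//; last first.
    exact: measurable_sum_gt.
  pose J i := X i @^-1` `](x - K)%R, +oo[%classic.
  have mJ i : measurable (J i) by exact: measurable_funPTI.
  have mUJ : measurable (\bigcup_(i in [set` s]) J i).
    by apply: fin_bigcup_measurable => //; exact: finite_seq.
  apply: (@le_trans _ _ (P (E `|` \bigcup_(i in [set` s]) J i))).
    apply: le_measure; rewrite ?inE//.
    - exact: measurable_sum_gt.
    - exact: measurableU.
    move=> w xS.
    have [/allP sK|/allPn[i si]] := boolP (all (fun i => X i w <= x - K) s).
      by left; split.
    by rewrite -ltNge => KX; right; exists i => //=; rewrite /J/= in_itv/= KX.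
  apply: le_trans (measureU2 _ mE mUJ) _.
  rewrite fineK ?fin_num_measure//; apply: leeD2l.
  apply: le_trans (measure_bigcup_seq_le _ _ mJ) _.
  rewrite (eq_bigr (fun=> (tail F (x - K))%:E)); last first.
    by move=> i _; rewrite EFin_tail -(iidX.2 i).
  by rewrite sumEFin big_const_seq count_predT ss iter_addr addr0 mulr_natl.
have half x : Num.max x0 x1 <= x -> tail G x <= 2 * C * n.+1%:R * tail F (x - K).
  rewrite ge_max => /andP[xx0 xx1].
  have pg := HK _ _ _ _ _ _ iidX us ss x xx1; have hpf := jump x.
  have gh := GF x xx0; move: pg hpf gh.
  set p := fine _; set h := tail (conv_pow F n.+1) x.
  set g := tail _ x; set f := tail F _.
  rewrite ler_pdivlMl ?mulr_gt0// => pg hpf gh.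
  have : C * h <= C * p + C * (n.+1%:R * f) by rewrite -mulrDr ler_pM2l.
  lra.
apply: (@tail_dominated_near _ _ _ (c / tail G K * (2 * C * n.+1%:R))
  (Num.max x0 x1 - K)) => // y; rewrite lerBlDr => yK.
have yx0 : x0 <= y + K by apply: le_trans yK; rewrite le_max lexx.
have := tail_shift_bound K FG G2 yx0; rewrite addrK => /le_trans; apply.
rewrite -[leRHS]mulrA; apply: ler_wpM2l; first by rewrite divr_ge0 ?tail_ge0// ltW.
by have := half _ yK; rewrite addrK.
Qed.

Lemma class_J_random_sum :
  class_J G -> asymp_equiv (tail F) (tail G) /\ class_J F.
Proof.
move=> JG; have [tightG [C C0 GF]] := class_J_dominated_by_step JG.
split; last exact: class_J_of_domination GF conv_pow_dominated tightG.
have [C' C'0 FG'] := conv_pow_dominated 1.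
apply: (@asymp_equiv_bounds _ _ _ (Num.max 1 (Num.max C C')) 0).
  by rewrite lt_max ltr01.
move=> x _; split; first exact: FG.2.
  rewrite -(eq_tail x (conv_pow1 F)); apply: le_trans (FG' x) _.
  by apply: ler_wpM2r; rewrite ?tail_ge0// !le_max lexx !orbT.
by apply: le_trans (GF x) _; apply: ler_wpM2r; rewrite ?tail_ge0// !le_max lexx !orbT.
Qed.

End domination.

Theorem proposition16 (R : realType)
  (d : measure_display) (T : measurableType d) (P : probability T R)
  (F : probability R R) (X : nat -> {RV P >-> R}) (N : {RV P >-> nat})
  (d' : measure_display) (T' : measurableType d') (P' : probability T' R)
  (N1 N2 : {RV P' >-> nat}) :
  class_F F ->
  iid_with_law X F ->
  independent_systems P (sigma_of N) (sigma_of_family X) ->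
  (P [set w | N w = 0%N] < 1)%E ->
  (forall n : nat, (0 < P [set w | (n < N w)%N])%E) ->
  same_law (distribution P' N1) (distribution P N) ->
  same_law (distribution P' N2) (distribution P N) ->
  independent_systems P' (sigma_of N1) (sigma_of N2) ->
  (limsup_conv_ratio (random_sum_law X N) <
   limn_einf
     (ereal_ratio (fun n : nat => fine (P' [set w | (n < N1 w + N2 w)%N]))
                  (fun n : nat => fine (P' [set w | (n < N1 w)%N]))))%E ->
  (class_OS (random_sum_law X N) ->
     exists m : nat, (0 < m)%N /\
       asymp_equiv (tail (conv_pow F m)) (tail (random_sum_law X N))) /\
  (class_J (random_sum_law X N) ->
     asymp_equiv (tail F) (tail (random_sum_law X N)) /\ class_J F).
Proof.
move=> FF iidX indN _ Npos lawN1 lawN2 ind12 gap; split.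
  by move=> [FG _]; exact: random_sum_asymp_conv_pow gap.
by move=> JG; exact: class_J_random_sum (JG.1) gap JG.
Qed.
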